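(* Let $K$ be an algebraically closed field of characteristic zero and $A=K+K[x]x^2$. In general, the invariance of degrees for decompositions of maximal length fails for irregular elements of $A$; that is, there exist an irregular element $a\in A\setminus K$ and two decompositions of maximal length $$a=p_1\circ\cdots\circ p_r=q_1\circ\cdots\circ q_r,\qquad r=l_A(a),$$ of $a$ into irreducible elements of $A$ such that there is no permutation $\sigma\in S_r$ with $\deg(p_j)=\deg(q_{\sigma(j)})$ for all $j=1,\ldots,r$.
   Context: Composition: $(a\circ b)(x):=a(b(x))$. $A=K+K[x]x^2=\{a\in K[x]\mid a'(0)=0\}$ is the subalgebra of $K[x]$ generated by $x^2,x^3$. A polynomial of $K[x]$ is irreducible if it has degree $>1$ and is not a composition of two polynomials of degree $>1$. An element of $A\setminus K$ is irreducible in $A$ if it is not of the form $b\circ c$ with $b,c\in A\setminus K$. For $a\in K[x]$ with $\deg a>1$, $l(a)$ is the number of factors in any decomposition of $a$ into irreducible polynomials of $K[x]$ (independent of the decomposition). For $a\in A\setminus K$, $l_A(a)$ is the maximal $r$ such that $a=p_1\circ\cdots\circ p_r$ with all $p_i$ irreducible in $A$; a decomposition into irreducible elements of $A$ is of maximal length if it has $l_A(a)$ factors. The element $a$ is irregular if $l_A(a)<l(a)$. $S_r$ is the symmetric group. *)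

(* Defs.v *)
From HB Require Import structures.
From mathcomp Require Import all_boot all_order all_algebra all_fingroup.

Set Implicit Arguments.
Unset Strict Implicit.
Unset Printing Implicit Defensive.

Import GRing.Theory.
Local Open Scope ring_scope.

Section Decompositions.
Variable K : fieldType.
Implicit Types (a p b c : {poly K}) (s : seq {poly K}).

Definition deg p : nat := (size p).-1.

(* A = K + K[x] x^2; see inAP for the description as a sum. *)
Definition inA a : Prop := a^`().[0] = 0.

Lemma inAP a : inA a <-> exists (k : K) (b : {poly K}), a = k%:P + b * 'X^2.
Proof.
rewrite /inA horner_coef0 coef_deriv mulr1n; split=> [a1|[k [b ->]]].
  exists a`_0, (drop_poly 2 a).
  rewrite -{1}(poly_take_drop 2 a); congr (_ + _).
  by apply/polyP=> -[|[|i]]; rewrite coef_take_poly coefC.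
by rewrite coefD coefC coefMXn add0r.
Qed.

(* a \in A \ K *)
Definition inA_nonconst a : Prop := inA a /\ (0 < deg a)%N.

Definition irreducible_comp p : Prop :=
  (1 < deg p)%N /\
  ~ (exists b c : {poly K}, [/\ (1 < deg b)%N, (1 < deg c)%N & p = b \Po c]).

Definition irreducibleA p : Prop :=
  inA_nonconst p /\
  ~ (exists b c : {poly K}, [/\ inA_nonconst b, inA_nonconst c & p = b \Po c]).

(* [:: p_1; ...; p_r] |-> p_1 o ... o p_r; the empty composition is 'X. *)
Definition compose s : {poly K} := foldr (fun p q => p \Po q) 'X s.

Definition decomposition a s : Prop :=
  (forall p, p \in s -> irreducible_comp p) /\ a = compose s.

Definition decompositionA a s : Prop :=
  (forall p, p \in s -> irreducibleA p) /\ a = compose s.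

(* l(a) = n, including the independence of the chosen decomposition *)
Definition is_length a (n : nat) : Prop :=
  (exists s, decomposition a s) /\ (forall s, decomposition a s -> size s = n).

(* l_A(a) = r *)
Definition is_lengthA a (r : nat) : Prop :=
  (exists2 s, decompositionA a s & size s = r) /\
  (forall s, decompositionA a s -> (size s <= r)%N).

(* l_A(a) < l(a) *)
Definition irregular a : Prop :=
  exists r n : nat, [/\ is_lengthA a r, is_length a n & (r < n)%N].

End Decompositions.

(* Main.v *)
Require Import Defs.
From HB Require Import structures.
From mathcomp Require Import all_boot all_order all_algebra all_fingroup.
From mathcomp Require Import zify.

Set Implicit Arguments.
Unset Strict Implicit.
Unset Printing Implicit Defensive.

Import GRing.Theory.
Local Open Scope ring_scope.

(** Put [h = x (x + 1)].  The example is [a = h^6], with the decompositions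
    [x^3 o h^2] and [x^2 o h^3], whose degrees are 3, 4 and 2, 6.

    What makes all decompositions of the powers of [h] accessible is that
    [h] has two simple roots: if [h^n = b o c] with [deg c > 1], then every
    [c - z], for [z] a root of [b], has its roots in [{0, -1}], and for
    distinct [z] these polynomials have no common root.  Two distinct [z]
    would make [c - z] proportional to a power of [x] and to a power of
    [x + 1]; then the derivative [c'] would be proportional both to [x^(d-1)]
    and to [(x + 1)^(d-1)], which in characteristic zero forces
    [d = deg c = 1].  So [b] is a power of a linear polynomial and [c] is an
    affine image of some [h^i] with [i] dividing [n] ([right_factor_powh]).

    Peeling off left factors one at a time, a decomposition of [h^n] in
    [K[x]] ends with [h] up to an affine map, and each other factor is, up to
    affine maps, a power [x^m] with [m] prime; its length is [Omega n + 1],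
    where [Omega n] counts the prime factors of [n] with multiplicity.  Inside
    [A] the last factor cannot be [h], because [h'(0) = 1]; it must already be
    affinely equivalent to [h^i] with [i > 1], and the length is at most
    [Omega n].  For [n = 6] this gives [l = 3] and [l_A = 2], while either
    prime divisor of 6 may be the exponent [i] of the last factor. *)

(** * The number of prime factors *)

Section PrimeFactors.
Local Open Scope nat_scope.

Definition Omega n := \sum_(p < n.+1) logn p n.

Lemma Omega_widen n N : n <= N -> Omega n = \sum_(p < N.+1) logn p n.
Proof.
move=> le_nN; rewrite /Omega -!(big_mkord xpredT (fun p => logn p n)).
rewrite [RHS](@big_cat_nat _ _ _ n.+1) //=.
rewrite [X in _ + X]big_nat [X in _ + X]big1 ?addn0 //.
move=> p /andP[lt_np _]; apply/eqP; rewrite -leqn0 leqNgt logn_gt0.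
rewrite mem_primes; apply/and3P=> -[_ n_gt0 /(dvdn_leq n_gt0)].
by rewrite leqNgt lt_np.
Qed.

Lemma OmegaM m n : 0 < m -> 0 < n -> Omega (m * n) = Omega m + Omega n.
Proof.
move=> m_gt0 n_gt0.
rewrite (@Omega_widen m (m * n)) ?leq_pmulr //.
rewrite (@Omega_widen n (m * n)) ?leq_pmull //.
by rewrite -big_split; apply: eq_bigr => p _; rewrite lognM.
Qed.

Lemma Omega_prime p : prime p -> Omega p = 1.
Proof.
move=> p_pr; rewrite /Omega big_ord_recr /= logn_prime // eqxx big1 // => i _.
by rewrite logn_prime // ltn_eqF.
Qed.

Lemma Omega1 : Omega 1 = 0.
Proof. by rewrite /Omega big1 // => p _; rewrite logn1. Qed.

Lemma Omega_gt0 n : 1 < n -> 0 < Omega n.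
Proof.
move=> n_gt1; have p_pr := pdiv_prime n_gt1.
have d_gt0 : 0 < n %/ pdiv n by rewrite divn_gt0 ?prime_gt0 ?pdiv_leq // ltnW.
by rewrite -(divnK (pdiv_dvd n)) OmegaM ?pdiv_gt0 // (Omega_prime p_pr) addn1.
Qed.

End PrimeFactors.

(** * Degrees and membership in the subalgebra *)

Section Degrees.
Variable K : fieldType.
Implicit Types (p q b c : {poly K}) (s : seq {poly K}).

Lemma deg_comp p q : deg (p \Po q) = (deg p * deg q)%N.
Proof. exact: size_comp_poly. Qed.

Lemma deg_exp p n : deg (p ^+ n) = (deg p * n)%N.
Proof. exact: size_exp. Qed.

Lemma deg_affine (k z : K) p : k != 0 -> deg (k *: p + z%:P) = deg p.
Proof.
move=> k0; have -> : k *: p + z%:P = (k *: 'X + z%:P) \Po p.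
  by rewrite comp_polyD comp_polyZ comp_polyX comp_polyC.
rewrite deg_comp -{2}(mul1n (deg p)); congr muln.
by rewrite /deg size_polyDl size_scale // size_polyX // ltnS size_polyC leq_b1.
Qed.

Lemma inA_coef p : inA p <-> p`_1 = 0.
Proof. by rewrite /inA horner_coef0 coef_deriv mulr1n. Qed.

Lemma inA_deg_gt1 p : inA_nonconst p -> (1 < deg p)%N.
Proof.
case=> /inA_coef p1 dp; rewrite ltn_neqAle dp andbT; apply/eqP => dp1.
have: lead_coef p = 0 by rewrite lead_coefE -/(deg p) -dp1.
by move/eqP; rewrite lead_coef_eq0 => /eqP p0; rewrite p0 /deg size_poly0 in dp.
Qed.

Lemma prime_deg_irreducible p : prime (deg p) -> irreducible_comp p.
Proof.
move=> dp; split; first exact: prime_gt1.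
case=> b [c [db dc def_p]]; move: dp; rewrite def_p deg_comp.
by case/primeP => _ /(_ _ (dvdn_mulr _ (dvdnn _))) /pred2P[]; nia.
Qed.

Lemma inA_irreducible p : inA p -> irreducible_comp p -> irreducibleA p.
Proof.
move=> pA [dp irr]; split; first by split=> //; apply: ltnW.
by case=> b [c [/inA_deg_gt1 db /inA_deg_gt1 dc def_p]]; apply: irr; exists b, c.
Qed.

Lemma deg_compose_gt1 s : s != [::] ->
  (forall p, p \in s -> 1 < deg p)%N -> (1 < deg (compose s))%N.
Proof.
elim: s => // p [_ _ /(_ p (mem_head _ _))|q s IHs _ ds].
  by rewrite /= comp_polyXr.
have := IHs isT (fun r rs => ds r (@mem_behead _ (p :: q :: s) _ rs)).
have := ds p (mem_head _ _).
rewrite -[compose [:: p, q & s]]/(p \Po compose (q :: s)) deg_comp.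
by move: (deg p) (deg _) => u v; nia.
Qed.

(** A factorization [m = u v] gives [x^m = x^v o x^u]. *)
Lemma irreducible_power_prime (l z g : K) m : l != 0 ->
  irreducible_comp (l *: ('X - z%:P) ^+ m + g%:P) -> prime m.
Proof.
move=> l0 [dm irr]; have dXz : deg ('X - z%:P) = 1%N by rewrite /deg size_XsubC.
rewrite deg_affine // deg_exp dXz mul1n in dm.
case: (boolP (prime m)) => // /primePn[|[u /andP[u_gt1 lt_um] /dvdnP[v def_m]]].
  by rewrite ltnNge dm.
case: irr; exists (l *: 'X^v + g%:P), (('X - z%:P) ^+ u).
rewrite deg_affine // !deg_exp dXz /deg size_polyX mul1n u_gt1.
split=> //; first by rewrite def_m in lt_um; rewrite mul1n; nia.
by rewrite comp_polyD comp_polyZ comp_polyC comp_Xn_poly -exprM mulnC -def_m.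
Qed.

End Degrees.

(** * Right factors of the powers of x (x + 1) *)

Section Powers.
Variable K : closedFieldType.
Hypothesis charK0 : [pchar K] =i pred0.
Implicit Types (p q b c : {poly K}) (s : seq {poly K}).

Definition h : {poly K} := 'X * ('X + 1).

Definition affine_powh (k : K) (i : nat) (z : K) := k *: h ^+ i + z%:P.

Lemma hE : h = ('X - 0%:P) * ('X - (-1)%:P).
Proof. by rewrite /h polyC0 subr0 polyCN opprK. Qed.

Lemma deg_h : deg h = 2%N.
Proof.
by rewrite hE /deg size_Mmonic ?monicXsubC ?polyXsubC_eq0 // !size_XsubC.
Qed.

Lemma h_neq0 : h != 0.
Proof. by rewrite -size_poly_gt0; move: deg_h; rewrite /deg; case: (size h). Qed.

Lemma coef1_h : h`_1 = 1.
Proof. by rewrite coefXM coefD coefX coef1 add0r. Qed.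

Lemma deg_affine_powh k i z : k != 0 -> deg (affine_powh k i z) = (2 * i)%N.
Proof. by move=> k0; rewrite deg_affine // deg_exp deg_h. Qed.

Lemma powhE k i z : affine_powh k i z = (k *: 'X^i + z%:P) \Po h.
Proof. by rewrite comp_polyD comp_polyZ comp_Xn_poly comp_polyC. Qed.

Lemma expr_powh i : h ^+ i = affine_powh 1 i 0.
Proof. by rewrite /affine_powh scale1r addr0. Qed.

Lemma inA_powh k i z : k != 0 -> (0 < i)%N ->
  inA (affine_powh k i z) <-> (1 < i)%N.
Proof.
move=> k0; case: i => [//|[|i]] _; rewrite inA_coef coefD coefZ coefC addr0.
  by rewrite expr1 coef1_h mulr1; split=> // /eqP; rewrite (negPf k0).
by split=> // _; rewrite /h exprMn coefXnM mulr0.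
Qed.

Lemma neq0N1 : (0 : K) != -1.
Proof. by rewrite eq_sym oppr_eq0 oner_eq0. Qed.

Lemma root_powh n x : root (h ^+ n) x -> x \in [:: 0; -1].
Proof.
rewrite /root horner_exp expf_eq0 => /andP[_].
by rewrite hE hornerM !hornerXsubC mulf_eq0 !subr_eq0 !inE.
Qed.

Lemma mupZ (x l : K) q : l != 0 -> mup x (l *: q) = mup x q.
Proof. by move=> l0; rewrite -mul_polyC mupMr // rootC. Qed.

Lemma mup_expn (x : K) q n : q != 0 -> mup x (q ^+ n) = (mup x q * n)%N.
Proof.
move=> q0; elim: n => [|n IHn]; first by rewrite mupNroot ?muln0 // root1.
by rewrite exprS mupM ?expf_neq0 // IHn mulnS.
Qed.

Lemma mup_h (x : K) : x \in [:: 0; -1] -> mup x h = 1%N.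
Proof.
move=> xE; have -> : h = ('X - 0%:P) ^+ 1 * ('X - (-1)%:P) ^+ 1.
  by rewrite hE.
rewrite mupM ?expf_neq0 ?polyXsubC_eq0 // !mup_XsubCX.
move: xE; rewrite !inE => /pred2P[]->; rewrite eqxx ?(negPf neq0N1) //.
by rewrite eq_sym (negPf neq0N1).
Qed.

Lemma two_roots_power (u v : K) q : u != v -> q != 0 ->
    (forall x, root q x -> x \in [:: u; v]) ->
  q = lead_coef q *: (('X - u%:P) ^+ mup u q * ('X - v%:P) ^+ mup v q).
Proof.
move=> neq_uv q0 qR; have [r def_q] := closed_field_poly_normal q.
have l0 : lead_coef q != 0 by rewrite lead_coef_eq0.
have rR : {subset r <= [:: u; v]}.
  move=> x xr; apply: qR; rewrite def_q rootZ //.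
  by rewrite root_prod_XsubC.
rewrite {1 3 4}def_q !mupZ // !mu_prod_XsubC; congr (_ *: _).
elim: r rR {def_q} => [|x r IHr] rR; first by rewrite big_nil /= !expr0 mulr1.
rewrite big_cons IHr => [|y yr]; last by apply: rR; rewrite inE yr orbT.
have := rR x (mem_head _ _); rewrite !inE => /pred2P[]-> /=; rewrite eqxx.
  by rewrite (negPf neq_uv) add0n mulrA -exprS.
by rewrite eq_sym (negPf neq_uv) add0n exprS mulrCA.
Qed.

(** The derivative of the left side vanishes at [u] as soon as [i > 1], and
    that of the right side only at [v], the characteristic being zero. *)
Lemma power_translates_deg1 (k l g u v : K) i j : u != v -> k != 0 -> l != 0 ->
  k *: ('X - u%:P) ^+ i + g%:P = l *: ('X - v%:P) ^+ j -> (i <= 1)%N.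
Proof.
move=> neq_uv k0 l0 E; rewrite leqNgt; apply/negP => i_gt1.
have ij : i = j.
  move: (congr1 (@deg K) E).
  rewrite deg_affine // -[l *: _]addr0 -polyC0 deg_affine //.
  by rewrite !deg_exp /deg !size_XsubC !mul1n.
have := congr1 (fun p => p^`().[u]) E => /=.
rewrite derivD derivC addr0 !derivZ !deriv_exp !derivXsubC !mul1r.
rewrite -ij !(hornerZ, hornerMn, horner_exp, hornerXsubC) subrr.
case: i i_gt1 {E ij} => [|[|i]] //= _.
rewrite expr0n /= mul0rn mulr0 => /esym/eqP.
rewrite mulf_eq0 (negPf l0) -mulr_natr mulf_eq0 ((pcharf0P K).1 charK0) orbF /=.
by rewrite expf_eq0 subr_eq0 (negPf neq_uv) andbF.
Qed.

(** The fibers of [c] over the roots of [b] are disjoint and lie in [{0, -1}],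
    so [b] has at most the two roots [c(0)] and [c(-1)].  If these differ, both
    fibers are single points, which [power_translates_deg1] excludes.  If they
    agree, [k h^n] is a power of [c - c(0)] up to a scalar, and comparing the
    multiplicities of 0 and -1 identifies [c]. *)
Lemma right_factor_powh n (k z : K) b c :
    (0 < n)%N -> k != 0 -> (1 < deg c)%N -> affine_powh k n z = b \Po c ->
  exists (m i : nat) (k' z' l : K),
    [/\ n = (m * i)%N, k' != 0, l != 0, c = affine_powh k' i z'
      & b = l *: ('X - z'%:P) ^+ m + z%:P].
Proof.
move=> n_gt0 k0 dc; rewrite /affine_powh => def_bc.
have {def_bc} : k *: h ^+ n = (b - z%:P) \Po c.
  by rewrite comp_polyB comp_polyC -def_bc addrK.
have -> : b = (b - z%:P) + z%:P by rewrite subrK.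
move: (b - z%:P) => {}b; rewrite addrK => def_hn.
have hn0 : k *: h ^+ n != 0 by rewrite scaler_eq0 negb_or k0 expf_neq0 ?h_neq0.
have b0 : b != 0 by apply: contraNneq hn0 => b0; rewrite def_hn b0 comp_poly0.
have c_neqC w : c - w%:P != 0.
  rewrite subr_eq0; apply: contraTneq dc => ->.
  by rewrite /deg size_polyC; case: eqP.
have fiber w : root b w -> forall x, root (c - w%:P) x -> x \in [:: 0; -1].
  move=> bw x cx; apply: (@root_powh n); rewrite -(rootZ _ _ k0) def_hn root_comp.
  by move: cx; rewrite /root hornerD hornerN hornerC subr_eq0 => /eqP->.
have fiberE w x : root (c - w%:P) x = (c.[x] == w).
  by rewrite /root hornerD hornerN hornerC subr_eq0.
have b_root x : x \in [:: 0; -1] -> root b c.[x].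
  move=> xE; rewrite -root_comp -def_hn rootZ // /root horner_exp.
  rewrite !inE in xE; rewrite hE hornerM !hornerXsubC.
  by rewrite expf_eq0 n_gt0 /= mulf_eq0 !subr_eq0.
have in0 : (0 : K) \in [:: 0; -1] by rewrite inE eqxx.
have in1 : (-1 : K) \in [:: 0; -1] by rewrite !inE eqxx orbT.
have [c01|c01] := eqVneq c.[0] c.[-1]; last first.
  have E0 := two_roots_power neq0N1 (c_neqC _) (fiber _ (b_root 0 in0)).
  have E1 := two_roots_power neq0N1 (c_neqC _) (fiber _ (b_root (-1) in1)).
  rewrite (@mupNroot _ (-1)) ?fiberE 1?eq_sym // mulr1 in E0.
  rewrite (@mupNroot _ 0) ?fiberE // mul1r in E1.
  have l0 w : lead_coef (c - w%:P) != 0 by rewrite lead_coef_eq0.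
  have : c - c.[-1]%:P = (c - c.[0]%:P) + (c.[0] - c.[-1])%:P.
    by rewrite polyCB addrA subrK.
  rewrite {1}E1 {1}E0 => /esym/(power_translates_deg1 neq0N1 (l0 _) (l0 _)).
  have dcE : deg c = deg (c - c.[0]%:P).
    by rewrite -polyCN -[c in RHS]scale1r deg_affine ?oner_eq0.
  rewrite dcE E0 -[_ *: _]addr0 -polyC0 deg_affine // in dc.
  rewrite deg_exp /deg size_XsubC mul1n in dc.
  by rewrite leqNgt dc.
set w := c.[0] in c01.
have bw x : root b x -> x = w.
  move=> bx; have [y] : exists y, root (c - x%:P) y.
    apply/closed_rootP; rewrite -polyCN size_polyDl.
      by apply: contraTneq dc => dc; rewrite /deg dc.
    by rewrite (leq_ltn_trans (size_polyC_leq1 _)) // -ltn_predRL // ltnW.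
  move=> cy; have := fiber _ bx _ cy; move: cy; rewrite fiberE !inE.
  by move=> /eqP <- /pred2P[]->.
have [m def_b] : exists m, b = lead_coef b *: ('X - w%:P) ^+ m.
  have [r def_b] := closed_field_poly_normal b; exists (size r).
  have rE x : x \in r -> x = w.
    move=> xr; apply: bw; rewrite def_b rootZ ?lead_coef_eq0 //.
    by rewrite root_prod_XsubC.
  rewrite {1}def_b big_seq (eq_bigr (fun=> 'X - w%:P)) => [|x /rE-> //].
  by rewrite -big_seq big_const_seq count_predT iter_mulr_1.
have lb0 : lead_coef b != 0 by rewrite lead_coef_eq0.
have lc0 : lead_coef (c - w%:P) != 0 by rewrite lead_coef_eq0.
have E : k *: h ^+ n = lead_coef b *: (c - w%:P) ^+ m.
  rewrite def_hn {1}def_b comp_polyZ rmorphXn /=.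
  by rewrite comp_polyB comp_polyX comp_polyC.
have mupE x : x \in [:: 0; -1] -> (mup x (c - w%:P) * m)%N = n.
  move=> xE; rewrite -mup_expn // -(@mupZ _ (lead_coef b)) // -E.
  by rewrite mupZ // mup_expn ?h_neq0 // mup_h // mul1n.
have m_gt0 : (0 < m)%N by move: n_gt0; rewrite -(mupE 0 in0) muln_gt0 => /andP[].
have mup01 : mup (-1) (c - w%:P) = mup 0 (c - w%:P).
  by apply/eqP; rewrite -(eqn_pmul2r m_gt0) !mupE.
have bw0 : root b w by apply: b_root in0.
have cE := two_roots_power neq0N1 (c_neqC _) (fiber _ bw0).
exists m, (mup 0 (c - w%:P)), (lead_coef (c - w%:P)), w, (lead_coef b).
split=> //; first by rewrite mulnC mupE ?in0.
  by rewrite /affine_powh hE exprMn -{2}mup01 -cE subrK.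
by rewrite -def_b.
Qed.

(** * Lengths of the decompositions of the powers of x (x + 1) *)

(** By [right_factor_powh], removing the first factor from a decomposition
    divides the exponent of [h] by a prime, until [h] itself is left. *)
Lemma length_powh n (k z : K) s : (0 < n)%N -> k != 0 ->
    (forall p, p \in s -> irreducible_comp p) -> compose s = affine_powh k n z ->
  size s = (Omega n).+1.
Proof.
elim: s n k z => [|p s IHs] n k z n_gt0 k0 irr_s def_s.
  have := deg_affine_powh n z k0; rewrite -def_s /deg size_polyX; lia.
have p_irr : irreducible_comp p by apply: irr_s; apply: mem_head.
have {}irr_s q : q \in s -> irreducible_comp q.
  by move=> qs; apply: irr_s; rewrite inE qs orbT.
have [s0|s_neq0] := eqVneq s [::].
  rewrite s0 /= comp_polyXr in def_s *.
  have [n1|n_neq1] := eqVneq n 1%N; first by rewrite n1 Omega1.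
  case: p_irr => _ []; exists (k *: 'X^n + z%:P), h.
  rewrite -powhE deg_h deg_affine // deg_exp /deg size_polyX mul1n.
  by split=> //; lia.
have ds : (1 < deg (compose s))%N.
  by apply: deg_compose_gt1 => // q /irr_s[].
have [m [i [k' [z' [l [def_n k'0 l0 def_c def_p]]]]]] :=
  right_factor_powh n_gt0 k0 ds (esym def_s).
move: p_irr n_gt0; rewrite def_p def_n muln_gt0.
move=> /(irreducible_power_prime l0) m_pr /andP[m_gt0 i_gt0] /=.
by rewrite (IHs i k' z') // OmegaM // (Omega_prime m_pr) add1n.
Qed.

(** Each step from [h^n] down to a right factor [h^i] in [A] uses up at least
    one prime factor of [n], and the last right factor still has [i > 1]. *)
Lemma lengthA_powh n (k z : K) s : (0 < n)%N -> k != 0 ->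
    (forall p, p \in s -> irreducibleA p) -> compose s = affine_powh k n z ->
  (size s <= Omega n)%N.
Proof.
elim: s n k z => [//|p s IHs] n k z n_gt0 k0 irr_s def_s.
have [pA _] : irreducibleA p by apply: irr_s; apply: mem_head.
have {}irr_s q : q \in s -> irreducibleA q.
  by move=> qs; apply: irr_s; rewrite inE qs orbT.
have [s0|s_neq0] := eqVneq s [::].
  rewrite s0 /= comp_polyXr in def_s *; apply: Omega_gt0.
  by rewrite -(inA_powh z k0 n_gt0) -def_s; case: pA.
have ds : (1 < deg (compose s))%N.
  by apply: deg_compose_gt1 => // q /irr_s[/inA_deg_gt1].
have [m [i [k' [z' [l [def_n k'0 l0 def_c def_p]]]]]] :=
  right_factor_powh n_gt0 k0 ds (esym def_s).
have m_gt1 : (1 < m)%N.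
  move/inA_deg_gt1: pA; rewrite def_p deg_affine // deg_exp.
  by rewrite /deg size_XsubC mul1n.
have i_gt0 : (0 < i)%N by move: n_gt0; rewrite def_n muln_gt0 => /andP[].
have := IHs i k' z' i_gt0 k'0 irr_s def_c.
by have := Omega_gt0 m_gt1; rewrite def_n OmegaM ?(ltnW m_gt1) //=; lia.
Qed.

Lemma irreducible_h : irreducible_comp h.
Proof. by apply: prime_deg_irreducible; rewrite deg_h. Qed.

(** A proper right factor of [h^p] is affinely equivalent to [h], which is not
    critical at 0. *)
Lemma irreducibleA_prime_powh (p : nat) : prime p -> irreducibleA (h ^+ p).
Proof.
move=> p_pr; have p_gt0 := prime_gt0 p_pr; rewrite expr_powh.
have one0 : (1 : K) != 0 by rewrite oner_eq0.
split.
  split; first by apply/inA_powh => //; apply: prime_gt1.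
  by rewrite deg_affine_powh // muln_gt0.
case=> b [c [bA cA def_p]].
have [m [i [k' [z' [l [def_n k'0 l0 def_c def_b]]]]]] :=
  right_factor_powh p_gt0 one0 (inA_deg_gt1 cA) def_p.
have i_gt1 : (1 < i)%N.
  have i_gt0 : (0 < i)%N by move: p_gt0; rewrite def_n muln_gt0 => /andP[].
  by rewrite -(inA_powh z' k'0 i_gt0) -def_c; case: cA.
move/inA_deg_gt1: bA; rewrite def_b deg_affine // deg_exp.
rewrite /deg size_XsubC mul1n => m_gt1; move: p_pr; rewrite def_n.
by case/primeP => _ /(_ m (dvdn_mulr _ (dvdnn m))) /pred2P[]; nia.
Qed.

Lemma irreducible_prime_Xn (p : nat) : prime p ->
  irreducible_comp ('X^p : {poly K}).
Proof. by move=> p_pr; apply: prime_deg_irreducible; rewrite /deg size_polyXn. Qed.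

Lemma irreducibleA_prime_Xn (p : nat) : prime p -> irreducibleA ('X^p : {poly K}).
Proof.
move=> p_pr; apply: inA_irreducible (irreducible_prime_Xn p_pr).
by rewrite inA_coef coefXn ltn_eqF // prime_gt1.
Qed.

Lemma decompositionA_powh (p q : nat) : prime p -> prime q ->
  decompositionA (h ^+ (p * q)) [:: 'X^p; h ^+ q].
Proof.
move=> p_pr q_pr; split=> [r|]; last first.
  by rewrite /= comp_polyXr comp_Xn_poly -exprM mulnC.
rewrite !inE => /pred2P[]->; first exact: irreducibleA_prime_Xn.
exact: irreducibleA_prime_powh.
Qed.

Lemma Omega_6 : Omega 6 = 2%N.
Proof. by rewrite (@OmegaM 2 3) // !Omega_prime. Qed.

Lemma is_lengthA_powh6 : is_lengthA (h ^+ 6) 2.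
Proof.
split; first by exists [:: 'X^2; h ^+ 3] => //; apply: (@decompositionA_powh 2 3).
move=> s [irr_s def_s]; rewrite -Omega_6.
by apply: (@lengthA_powh 6 1 0) => //; rewrite ?oner_eq0 // -def_s expr_powh.
Qed.

Lemma is_length_powh6 : is_length (h ^+ 6) 3.
Proof.
split.
  exists [:: 'X^2; 'X^3; h]; split=> [p|].
    rewrite !inE => /or3P[]/eqP->; last exact: irreducible_h.
      exact: irreducible_prime_Xn.
    exact: irreducible_prime_Xn.
  by rewrite /= comp_polyXr !comp_Xn_poly -exprM.
move=> s [irr_s def_s]; rewrite -Omega_6.
by apply: (@length_powh 6 1 0) => //; rewrite ?oner_eq0 // -def_s expr_powh.
Qed.

Lemma inA_powh6 : inA_nonconst (h ^+ 6).
Proof.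
have one0 : (1 : K) != 0 by rewrite oner_eq0.
by rewrite expr_powh; split; [apply/inA_powh | rewrite deg_affine_powh].
Qed.

End Powers.

Theorem proposition3p6 (K : closedFieldType) (charK0 : [pchar K] =i pred0) :
  exists (a : {poly K}) (r : nat) (p q : r.-tuple {poly K}),
    [/\ inA_nonconst a /\ irregular a,
        is_lengthA a r,
        decompositionA a p,
        decompositionA a q
      & ~ (exists sigma : 'S_r,
             forall j : 'I_r, deg (tnth p j) = deg (tnth q (sigma j)))].
Proof.
exists (h K ^+ 6), 2%N, [tuple 'X^3; h K ^+ 2], [tuple 'X^2; h K ^+ 3]; split.
- split; first exact: inA_powh6.
  by exists 2%N, 3%N; split; [apply: is_lengthA_powh6 | apply: is_length_powh6 |].
- exact: is_lengthA_powh6.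
- exact: (@decompositionA_powh _ charK0 3 2).
- exact: (@decompositionA_powh _ charK0 2 3).
(* The degrees are 3, 4 on one side and 2, 6 on the other. *)
case=> sigma /(_ ord0); rewrite {1}/tnth /= {1}/deg size_polyXn.
case: (sigma ord0) => -[|[|//]] lt_j2; rewrite /tnth /=.
  by rewrite /deg size_polyXn.
by rewrite deg_exp deg_h.
Qed.
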